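(* Suppose that for each $N\ge 1$ we are given two hypotheses $\mathcal{H}_0^N,\mathcal{H}_1^N$ on the law of an observation $Y^N$, with densities $P_0(Y^N)$ and $P_1(Y^N)$, and likelihood ratio $L(Y^N)=P_1(Y^N)/P_0(Y^N)$. Suppose the Kullback-Leibler divergence rate $$\kappa = -\lim_{N\to\infty}\frac1N\,\mathbb{E}_0\log\frac{P_1(Y^N)}{P_0(Y^N)} = -\lim_{N\to\infty}\frac1N\,\mathbb{E}_0\log L(Y^N)$$ is well defined. Suppose furthermore that, under $\mathcal{H}_0$, the normalized log likelihood ratio $\ell_N=\frac1N\log L(Y^N)$ converges in probability to $-\kappa$. Then, for every fixed $\epsilon\in(0,1)$, the type-II error exponent $\eta=-\lim_{N\to\infty}\frac1N\log P_{\mathrm{miss}}(\delta_N)$ of the optimal detectors $\delta_N$ with false alarm constraint $P_{\mathrm{false\_alarm}}\le\epsilon$ is well defined (the limit exists), and $\eta=\kappa$.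
   Context: $\mathbb{E}_0$ is expectation under $\mathcal{H}_0$; $P_0(\cdot),P_1(\cdot)$ also denote the probability laws under $\mathcal{H}_0,\mathcal{H}_1$. A detector maps $Y^N$ to a decision in $\{\mathcal{H}_0,\mathcal{H}_1\}$; $P_{\mathrm{false\_alarm}}$ is the probability of deciding $\mathcal{H}_1$ under $\mathcal{H}_0$ and $P_{\mathrm{miss}}$ is the probability of deciding $\mathcal{H}_0$ under $\mathcal{H}_1$. The optimal (Neyman-Pearson) detector $\delta_N$ decides $\mathcal{H}_1$ if $\ell_N>\tau_N$ and $\mathcal{H}_0$ otherwise, with the threshold $\tau_N$ chosen to minimize $P_{\mathrm{miss}}$ subject to $P_{\mathrm{false\_alarm}}\le\epsilon$. *)

(* Defs.v *)
(* MathComp-Analysis. *)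
From HB Require Import structures.
From mathcomp Require Import all_boot all_order all_algebra.
From mathcomp Require Import all_classical all_reals all_analysis.

Set Implicit Arguments.
Unset Strict Implicit.
Unset Printing Implicit Defensive.

Import Order.TTheory GRing.Theory Num.Theory.
Import numFieldNormedType.Exports.

Local Open Scope classical_set_scope.
Local Open Scope ring_scope.
Local Open Scope ereal_scope.

Definition is_density (R : realType) (d : measure_display)
    (T : measurableType d) (mu : {measure set T -> \bar R})
    (P : probability T R) (p : T -> R) : Prop :=
  [/\ measurable_fun setT p,
      forall y, (0 <= p y)%R &
      forall A, measurable A -> P A = \int[mu]_(y in A) (p y)%:E].

(* With the conventions of [\bar R], the value is [+oo] where [p0 y = 0 < p1 y]
   and [0] where [p0 y = p1 y = 0]. *)
Definition likelihood_ratio (R : realType) (T : Type) (p0 p1 : T -> R) (y : T)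
    : \bar R :=
  (p1 y)%:E / (p0 y)%:E.

(* [lne 0 = -oo] and [lne +oo = +oo]. *)
Definition normalized_llr (R : realType) (T : Type) (N : nat)
    (p0 p1 : T -> R) (y : T) : \bar R :=
  (N%:R^-1)%:E * lne (likelihood_ratio p0 p1 y).

(* An infinite value of [X N] deviates from [c] by more than any [e]. *)
Definition cvg_in_probability (R : realType) (d : nat -> measure_display)
    (T : forall N, measurableType (d N)) (P : forall N, probability (T N) R)
    (X : forall N, T N -> \bar R) (c : R) : Prop :=
  forall e : R, (0 < e)%R ->
    P N [set y | e%:E < `|X N y - c%:E|] @[N --> \oo] --> 0.

Inductive hypothesis : Set := H0 | H1.

Definition p_false_alarm (R : realType) (d : measure_display)
    (T : measurableType d) (P0 : probability T R) (delta : T -> hypothesis)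
    : \bar R :=
  P0 [set y | delta y = H1].

Definition p_miss (R : realType) (d : measure_display)
    (T : measurableType d) (P1 : probability T R) (delta : T -> hypothesis)
    : \bar R :=
  P1 [set y | delta y = H0].

Definition threshold_detector (R : realType) (T : Type) (l : T -> \bar R)
    (tau : \bar R) (y : T) : hypothesis :=
  if tau < l y then H1 else H0.

(* Thresholds range over [\bar R]: when [P0 (l > -oo) <= eps] every real
   threshold is admissible and the minimum may only be reached at [-oo]. A real
   threshold optimal among the real ones is optimal in this sense too, by
   continuity of [P1] along [tau --> -oo]. *)
Definition optimal_threshold (R : realType) (d : measure_display)
    (T : measurableType d) (P0 P1 : probability T R) (l : T -> \bar R)
    (eps : R) (tau : \bar R) : Prop :=
  p_false_alarm P0 (threshold_detector l tau) <= eps%:E /\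
  forall tau' : \bar R,
    p_false_alarm P0 (threshold_detector l tau') <= eps%:E ->
    p_miss P1 (threshold_detector l tau)
      <= p_miss P1 (threshold_detector l tau').

(* Main.v *)
(* On the event [l <= t] (resp. [t <= l]) the density ratio [p1 / p0] is at most
   (resp. at least) [exp (N t)]. A threshold [- kappa + e] is eventually
   admissible, since [l] concentrates at [- kappa] under [P0], and its miss
   probability is at most [exp (- N (kappa - e))]; the optimal detector does no
   worse. Conversely, the acceptance region of any admissible test has
   [P0]-probability at least [1 - eps], so it shares mass bounded below with
   [- kappa - e <= l], and there [P1 >= exp (- N (kappa + e)) P0]. *)
Require Import Defs.
From HB Require Import structures.
From mathcomp Require Import all_boot all_order all_algebra.
From mathcomp Require Import all_classical all_reals all_analysis.
From mathcomp Require Import measurable_realfun ring lra.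
Set Implicit Arguments.
Unset Strict Implicit.
Import Order.TTheory GRing.Theory Num.Theory.
Import numFieldNormedType.Exports.
Local Open Scope classical_set_scope.
Local Open Scope ring_scope.
Local Open Scope ereal_scope.

Section LogLikelihoodRatio.
Context (R : realType) (d : measure_display) (T : measurableType d).
Variables (N : nat) (p0 p1 : T -> R).
Hypotheses (N_gt0 : (0 < N)%N)
  (p0_ge0 : forall y, (0 <= p0 y)%R) (p1_ge0 : forall y, (0 <= p1 y)%R).

Local Notation l := (normalized_llr N p0 p1).

(** Dividing by [N] keeps infinite values infinite since [N] is positive. The test on [p1] comes
    first because a vanishing [p1] gives [-oo] even where [p0] vanishes too. Measurability and both
    density comparisons are read off these three branches. *)
Lemma normalized_llrE : l =
  fun y => if (p1 y <= 0)%R then -oo else if (p0 y <= 0)%R then +oo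
           else (N%:R^-1 * (ln (p1 y) - ln (p0 y)))%:E.
Proof.
have N0 : (0 < N%:R^-1 :> R)%R by rewrite invr_gt0 ltr0n.
apply/funext => y; rewrite /normalized_llr /likelihood_ratio.
have [p1y|p1y] := leP (p1 y) 0%R.
  have -> : p1 y = 0%R by apply/le_anti; rewrite p1y p1_ge0.
  by rewrite mul0e le0_lneNy// gt0_muleNy// lte_fin.
have [p0y|p0y] := leP (p0 y) 0%R.
  have -> : p0 y = 0%R by apply/le_anti; rewrite p0y p0_ge0.
  by rewrite inve0 gt0_muley ?lte_fin//= gt0_muley// lte_fin.
rewrite inver gt_eqF// -EFinM lne_EFin ?divr_gt0//.
by rewrite ln_div ?posrE// -EFinM.
Qed.

Lemma measurable_normalized_llr :
  measurable_fun setT p0 -> measurable_fun setT p1 -> measurable_fun setT l.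
Proof.
move=> mp0 mp1; rewrite normalized_llrE.
apply: measurable_fun_ifT => //; first exact: measurable_fun_ler.
apply: measurable_fun_ifT => //; first exact: measurable_fun_ler.
apply/measurable_EFinP; apply: measurable_funM => //.
by apply: measurable_funB; apply: measurableT_comp => //; exact: measurable_ln.
Qed.

(** A real [t] rules out the value [-oo]. The value [+oo] means [p0 y = 0], and the bound is then
    nonnegativity of [p1]; otherwise exponentiate. *)
Lemma normalized_llr_ge (t : R) y :
  t%:E <= l y -> (expR (N%:R * t) * p0 y <= p1 y)%R.
Proof.
have N0 : (0 < N%:R :> R)%R by rewrite ltr0n.
rewrite normalized_llrE; have [//|p1y] := leP (p1 y) 0%R.
have [p0y _|p0y] := leP (p0 y) 0%R.
  have -> : p0 y = 0%R by apply/le_anti; rewrite p0y p0_ge0.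
  by rewrite mulr0.
rewrite lee_fin ler_pdivlMl// => tl.
by rewrite -[leRHS]lnK ?posrE// -[p0 y]lnK ?posrE// -expRD ler_expR -lerBrDr.
Qed.

Lemma normalized_llr_le (t : R) y :
  l y <= t%:E -> (p1 y <= expR (N%:R * t) * p0 y)%R.
Proof.
have N0 : (0 < N%:R :> R)%R by rewrite ltr0n.
rewrite normalized_llrE; have [p1y _|p1y] := leP (p1 y) 0%R.
  by rewrite (le_trans p1y)// mulr_ge0// expR_ge0.
have [//|p0y] := leP (p0 y) 0%R.
rewrite lee_fin ler_pdivrMl// => tl.
by rewrite -[leLHS]lnK ?posrE// -[p0 y]lnK ?posrE// -expRD ler_expR -lerBlDr.
Qed.

End LogLikelihoodRatio.

(** Change of measure: the pointwise comparison of densities is integrated over [A] against the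
    common reference [mu]. *)
Lemma le_probability_density (R : realType) (d : measure_display)
    (T : measurableType d) (mu : {measure set T -> \bar R})
    (P Q : probability T R) (p q : T -> R) (c : R) (A : set T) :
  is_density mu P p -> is_density mu Q q -> measurable A -> (0 <= c)%R ->
  (forall y, A y -> (c * p y <= q y)%R) -> c%:E * P A <= Q A.
Proof.
move=> [mp p0 Pp] [mq q0 Qq] mA c0 cpq.
have mE (f : T -> R) : measurable_fun setT f ->
    measurable_fun A (fun y => (f y)%:E).
  by move=> mf; apply/measurable_EFinP; exact: measurable_funTS.
rewrite Pp// Qq// -ge0_integralZl_EFin//; last 2 first.
- by move=> y _; rewrite lee_fin.
- exact: mE.
apply: ge0_le_integral => //.
- by move=> y _; rewrite mule_ge0 ?lee_fin.
- by under eq_fun do rewrite -EFinM; apply: mE; exact: measurable_funM.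
- exact: mE.
Qed.

Lemma ge_probability_density (R : realType) (d : measure_display)
    (T : measurableType d) (mu : {measure set T -> \bar R})
    (P Q : probability T R) (p q : T -> R) (c : R) (A : set T) :
  is_density mu P p -> is_density mu Q q -> measurable A -> (0 < c)%R ->
  (forall y, A y -> (q y <= c * p y)%R) -> Q A <= c%:E * P A.
Proof.
move=> Pp Qq mA c0 qcp.
(* The previous bound with [P] and [Q] exchanged and constant [c^-1], hence the strict positivity of
   [c]. *)
rewrite -lee_pdivrMl//; apply: (le_probability_density Qq Pp) => //.
  by rewrite invr_ge0 ltW.
by move=> y Ay; rewrite ler_pdivrMl// qcp.
Qed.

Lemma near_lt_cvge0 (R : realType) (f : nat -> \bar R) (e : R) :
  (0 < e)%R -> f N @[N --> \oo] --> 0 -> \forall N \near \oo, f N < e%:E.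
Proof.
move=> e0 f0; apply: (f0 [set x | x < e%:E]); apply: open_nbhs_nbhs.
by split; [exact: open_ereal_lt_ereal | rewrite /= lte_fin].
Qed.

Section Detection.
Context (R : realType) (d : measure_display) (T : measurableType d).
Variables (mu : {measure set T -> \bar R}) (P0 P1 : probability T R).
Variables (N : nat) (p0 p1 : T -> R).
Hypotheses (N_gt0 : (0 < N)%N)
  (hp0 : is_density mu P0 p0) (hp1 : is_density mu P1 p1).

Local Notation l := (normalized_llr N p0 p1).

Let ml : measurable_fun setT l.
Proof.
by case: hp0 hp1 => mp0 p0_ge0 _ [mp1 p1_ge0 _]; exact: measurable_normalized_llr.
Qed.

Lemma p_missE tau :
  p_miss P1 (threshold_detector l tau) = P1 [set y | l y <= tau].
Proof.
congr (P1 _); apply/seteqP; split=> y /=; rewrite /threshold_detector;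
  by case: ltP.
Qed.

Lemma p_false_alarmE tau :
  p_false_alarm P0 (threshold_detector l tau) = P0 [set y | tau < l y].
Proof.
congr (P0 _); apply/seteqP; split=> y /=; rewrite /threshold_detector;
  by case: ltP.
Qed.

Let measurable_llr_le tau : measurable [set y | l y <= tau].
Proof. by rewrite -[X in measurable X]setTI; exact: emeasurable_fun_infty_c. Qed.

Let measurable_llr_gt tau : measurable [set y | tau < l y].
Proof. by rewrite -[X in measurable X]setTI; exact: emeasurable_fun_o_infty. Qed.

Let measurable_llr_ge tau : measurable [set y | tau <= l y].
Proof. by rewrite -[X in measurable X]setTI; exact: emeasurable_fun_c_infty. Qed.

Let measurable_llr_dist (c e : R) :
  measurable [set y | e%:E < `|l y - c%:E|].
Proof.
rewrite -[X in measurable X]setTI; apply: emeasurable_fun_o_infty => //.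
by apply: measurableT_comp => //; apply: emeasurable_funB.
Qed.

Lemma p_miss_le (t : R) :
  p_miss P1 (threshold_detector l t%:E) <= (expR (N%:R * t))%:E.
Proof.
have [[_ p0_ge0 _] [_ p1_ge0 _]] := (hp0, hp1).
rewrite p_missE.
apply: (@le_trans _ _ ((expR (N%:R * t))%:E * P0 [set y | l y <= t%:E])).
  apply: (ge_probability_density hp0 hp1) => //; first exact: expR_gt0.
  by move=> y; exact: normalized_llr_le.
by rewrite -[leRHS]mule1 lee_pmul2l ?probability_le1 ?lte_fin ?expR_gt0.
Qed.

Lemma p_false_alarm_le (c e : R) :
  p_false_alarm P0 (threshold_detector l (c + e)%:E) <=
  P0 [set y | e%:E < `|l y - c%:E|].
Proof.
rewrite p_false_alarmE; apply: le_measure; rewrite ?inE// => y /=.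
case: (l y) => [r| |]//=; last by rewrite !ltry.
by rewrite !lte_fin => cr; rewrite (lt_le_trans _ (ler_norm _))//; lra.
Qed.

(** Missing is likely under [P1] because the acceptance region [A] meets [C], where [P1] dominates a
    multiple of [P0], in a set of [P0]-mass at least [1 - eps - dlt]. *)
Lemma p_miss_ge (c e eps dlt : R) (tau : \bar R) :
  p_false_alarm P0 (threshold_detector l tau) <= eps%:E ->
  P0 [set y | e%:E < `|l y - c%:E|] <= dlt%:E ->
  (expR (N%:R * (c - e)) * (1 - eps - dlt))%:E <=
  p_miss P1 (threshold_detector l tau).
Proof.
have [[_ p0_ge0 _] [_ p1_ge0 _]] := (hp0, hp1).
rewrite p_missE p_false_alarmE => fa dev.
set A := [set y | l y <= tau] in fa *; set C := [set y | (c - e)%:E <= l y].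
have [mA mC] : measurable A /\ measurable C.
  by split; [exact: measurable_llr_le | exact: measurable_llr_ge].
have mAC : measurable (A `&` C) by exact: measurableI.
apply: (@le_trans _ _ (P1 (A `&` C))); last exact: measureIl.
apply: (@le_trans _ _ ((expR (N%:R * (c - e)))%:E * P0 (A `&` C))); last first.
  apply: (le_probability_density hp0 hp1) => //.
  by move=> y [_]; exact: normalized_llr_ge.
rewrite EFinM lee_pmul2l ?fin_numE ?lte_fin ?expR_gt0//.
(* Union bound: outside [A] the detector raises a false alarm, and outside [C] the statistic
   deviates from [c] by more than [e], the value [-oo] included. *)
have: 1 <= P0 (A `&` C) + (dlt + eps)%:E.
  rewrite -(@probability_setT _ _ _ P0).
  have -> : setT = (A `&` C) `|`
      ([set y | e%:E < `|l y - c%:E|] `|` [set y | tau < l y]).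
    apply/esym/seteqP; split=> // y _ /=.
    have [|ly] := ltP tau (l y); first by right; right.
    have [cl|cl] := leP (c - e)%:E (l y); first by left.
    right; left; move: cl; case: (l y) => [r| |]//=; last by rewrite !ltry.
    by rewrite !lte_fin => rc; rewrite -normrN (lt_le_trans _ (ler_norm _))//; lra.
  apply: le_trans (measureU2 _ _ _) _ => //; first exact: measurableU.
  rewrite leeD2l// (le_trans (measureU2 _ _ _))// EFinD leeD//.
rewrite -(fineK (fin_num_measure P0 _ mAC)) -!EFinD !lee_fin; lra.
Qed.

End Detection.

Theorem lemma1 (R : realType)
    (d : nat -> measure_display) (T : forall N : nat, measurableType (d N))
    (mu : forall N : nat, {measure set (T N) -> \bar R})
    (P0 P1 : forall N : nat, probability (T N) R)
    (p0 p1 : forall N : nat, T N -> R)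
    (hp0 : forall N : nat, (0 < N)%N -> is_density (mu N) (P0 N) (p0 N))
    (hp1 : forall N : nat, (0 < N)%N -> is_density (mu N) (P1 N) (p1 N))
    (kappa : R)
    (hkappa : - ((N%:R^-1)%:E *
                 \int[P0 N]_y lne (likelihood_ratio (p0 N) (p1 N) y))
              @[N --> \oo] --> kappa%:E)
    (hcvg : cvg_in_probability P0
              (fun N : nat => normalized_llr N (p0 N) (p1 N)) (- kappa)%R)
    (eps : R) (heps0 : (0 < eps)%R) (heps1 : (eps < 1)%R)
    (tau : nat -> \bar R)
    (htau : forall N : nat, (0 < N)%N ->
       optimal_threshold (P0 N) (P1 N) (normalized_llr N (p0 N) (p1 N))
         eps (tau N)) :
  - ((N%:R^-1)%:E *
     lne (p_miss (P1 N) (threshold_detector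
                           (normalized_llr N (p0 N) (p1 N)) (tau N))))
    @[N --> \oo] --> kappa%:E.
Proof.
have delta_gt0 : (0 < (1 - eps) / 2)%R by lra.
pose m N := p_miss (P1 N)
  (threshold_detector (normalized_llr N (p0 N) (p1 N)) (tau N)).
have miss_bounds (e : R) : (0 < e)%R -> \forall N \near \oo,
    (expR (N%:R * (- kappa - e)) * ((1 - eps) / 2))%:E <= m N /\
    m N <= (expR (N%:R * (- kappa + e)))%:E.
  move=> e0; near=> N.
  have N0 : (0 < N)%N by near: N; exact: nbhs_infty_gt.
  have [fa opt] := htau N N0.
  split.
    (* Half of the mass [1 - eps] is allotted to the deviation event, so the other half survives as
       a constant independent of [N]. *)
    have -> : ((1 - eps) / 2 = 1 - eps - (1 - eps) / 2)%R by lra.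
    apply: (p_miss_ge N0 (hp0 N N0) (hp1 N N0)) fa _.
    by apply: ltW; near: N; exact: near_lt_cvge0 (hcvg _ e0).
  (* Compare with the threshold [- kappa + e]: its false alarms are deviations, whose probability
     eventually falls below [eps > 0]. *)
  apply: le_trans (opt _ _) (p_miss_le N0 (hp0 N N0) (hp1 N N0) _).
  apply: le_trans (p_false_alarm_le N0 (hp0 N N0) (hp1 N N0) _ _) _.
  by apply: ltW; near: N; exact: near_lt_cvge0 (hcvg _ e0).
have log_bounds (e : R) : (0 < e)%R -> \forall N \near \oo,
    exists2 r : R, - ((N%:R^-1)%:E * lne (m N)) = r%:E & (`|kappa - r| <= e)%R.
  (* One half of [e] bounds the error in the exponent; the other absorbs the constant factor
     [(1 - eps) / 2], whose logarithm is at least [- N e / 2] once [N] is large. *)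
  move=> e0; have e20 : (0 < e / 2)%R by lra.
  near=> N.
  have N0 : (0 < N%:R :> R)%R by rewrite ltr0n; near: N; exact: nbhs_infty_gt.
  have [lo up] : (expR (N%:R * (- kappa - e / 2)) * ((1 - eps) / 2))%:E <= m N /\
      m N <= (expR (N%:R * (- kappa + e / 2)))%:E.
    by near: N; exact: miss_bounds.
  have lnN : (- ln ((1 - eps) / 2) / (e / 2) <= N%:R)%R.
    by near: N; exact: nbhs_infty_ger.
  (* The two bounds exclude infinite values, and the lower one makes [x] positive, so [lne] is the
     real logarithm here. *)
  move: lo up; case: (m N) => [x| |]//; rewrite !lee_fin => lo up.
  have c0 : (0 < expR (N%:R * (- kappa - e / 2)) * ((1 - eps) / 2))%R.
    by rewrite mulr_gt0 ?expR_gt0.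
  have x0 : (0 < x)%R := lt_le_trans c0 lo.
  exists (- (N%:R^-1 * ln x))%R; first by rewrite lne_EFin// -EFinM -EFinN.
  move: lo up; rewrite -ler_ln ?posrE// lnM ?posrE ?expR_gt0// expRK => lo.
  rewrite -ler_ln ?posrE ?expR_gt0// expRK => up.
  rewrite ler_pdivrMr// in lnN.
  have -> : (kappa - - (N%:R^-1 * ln x) = N%:R^-1 * (N%:R * kappa + ln x))%R.
    by field; rewrite gt_eqF.
  rewrite normrM gtr0_norm ?invr_gt0// ler_pdivrMl// ler_norml.
  have Ne : (0 < N%:R * e)%R by rewrite mulr_gt0.
  by apply/andP; split; nra.
(* Convergence in [\bar R] to a real limit: the terms are eventually finite (any tolerance shows it,
   here 1), and their real values converge. *)
apply/fine_cvgP; split.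
  by apply: filterS (log_bounds _ ltr01) => N [r -> _].
apply/cvgrPdist_le => e e0.
by apply: filterS (log_bounds _ e0) => N [r /= -> ].
Unshelve. all: by end_near.
Qed.
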